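(* Let $\sigma^2>0$, let $\varphi:[0,\infty)\to\mathbb{R}$ be a Stieltjes function with $\varphi(0)=1$, and let $\psi:[0,\infty)\to(0,\infty)$ be strictly positive with a completely monotone derivative. Define $$C(\theta,u)=\frac{\sigma^2}{\psi(u^2)}\,\varphi\!\left(\frac{\theta}{\psi(u^2)}\right),\qquad \theta\in[0,\pi],\ u\in\mathbb{R}.$$ Then $C$ is a covariance function on $\mathbb{S}^d\times\mathbb{R}$ for every positive integer $d$.
   Context: A function $\varphi:[0,\infty)\to\mathbb{R}$ is a Stieltjes function if $\varphi(t)=\int_{[0,\infty)}\frac{\mu(d\xi)}{t+\xi}$ for $t\ge0$, where $\mu$ is a positive bounded measure; the requirement $\varphi(0)=1$ means $\int\xi^{-1}\mu(d\xi)=1$. A function $f$ on $(0,\infty)$ is completely monotone if it is infinitely differentiable with $(-1)^nf^{(n)}(t)\ge0$ for all $n\ge0$, $t>0$. $\mathbb{S}^d=\{\mathbf{s}\in\mathbb{R}^{d+1}:\|\mathbf{s}\|=1\}$ with great circle distance $\theta(\mathbf{s}_1,\mathbf{s}_2)=\arccos(\mathbf{s}_1^\top\mathbf{s}_2)$. $C:[0,\pi]\times\mathbb{R}\to\mathbb{R}$ is a covariance function on $\mathbb{S}^d\times\mathbb{R}$ if for every finite collection $(\mathbf{s}_k,t_k)\in\mathbb{S}^d\times\mathbb{R}$ and reals $a_k$, $\sum_{k,h}a_ka_hC(\theta(\mathbf{s}_k,\mathbf{s}_h),t_k-t_h)\ge0$.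
   Formalization: ψ is additionally assumed continuous on [0,∞), in effect at 0; without this the claim fails, e.g. for ψ(0)=2 and ψ=1 on (0,∞), where C(0,0)=σ²/2 is smaller than C(0,u)=σ². *)

(* Defs.v *)
From HB Require Import structures.
From mathcomp Require Import all_boot all_order all_algebra.
From mathcomp Require Import all_classical all_reals all_analysis.
Set Implicit Arguments. Unset Strict Implicit. Unset Printing Implicit Defensive.
Import Order.TTheory GRing.Theory Num.Theory.
Import numFieldNormedType.Exports.
Local Open Scope classical_set_scope.
Local Open Scope ring_scope.

Definition stieltjes_kernel (R : realType) (t xi : R) : \bar R :=
  if t + xi == 0 then +oo%E else ((t + xi)^-1)%:E.

Definition halfline0 (R : realType) : set R := [set` `[(0:R), +oo[].

Definition stieltjes_function (R : realType) (phi : R -> R) : Prop :=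
  exists mu : {measure set R -> \bar R},
    (mu setT < +oo)%E /\ mu [set` `]-oo, 0[] = 0%E /\
    forall t : R, 0 <= t ->
      (phi t)%:E = (\int[mu]_(xi in @halfline0 R) stieltjes_kernel t xi)%E.

Definition completely_monotone (R : realType) (f : R -> R) : Prop :=
  (forall n t, 0 < t -> derivable (derive1n n f) t 1) /\
  (forall n t, 0 < t -> 0 <= (-1) ^+ n * derive1n n f t).

Definition dotp (R : realType) (d : nat) (s1 s2 : 'rV[R]_d) : R :=
  \sum_(i < d) s1 ord0 i * s2 ord0 i.

Definition on_sphere (R : realType) (d : nat) (s : 'rV[R]_d.+1) : Prop :=
  dotp s s = 1.

Definition gc_dist (R : realType) (d : nat) (s1 s2 : 'rV[R]_d.+1) : R :=
  acos (dotp s1 s2).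

Definition covariance_on_sphere_time (R : realType) (d : nat) (C : R -> R -> R)
  : Prop :=
  forall (n : nat) (s : 'I_n -> 'rV[R]_d.+1) (t a : 'I_n -> R),
    (forall k, on_sphere (s k)) ->
    0 <= \sum_(k < n) \sum_(h < n) a k * a h * C (gc_dist (s k) (s h)) (t k - t h).

(* Main.v *)
(** A Stieltjes function is a mixture of [t |-> 1 / (t + xi)], so [C] is a
    mixture over [xi > 0] of the kernels [1 / (theta + xi * psi (u^2))], and the
    entrywise inverse of a positive conditionally negative definite (cnd) kernel
    [N] is positive semidefinite (psd): with a base point [p], the kernel
    [c i j = 1 - N i j * N p p / (N i p * N j p)] is psd with diagonal [< 1], and
    [1 / (1 - c)] is a geometric series in [c].

    [theta = acos <s, s'>] is cnd because the derivative in [r] of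
    [- acos (r * x)] is [x / sqrt (1 - r^2 x^2)], which is psd in [x = <s, s'>].

    [psi (u^2)] is cnd without Bernstein's theorem on completely monotone
    functions: the Taylor expansion of [- psi] at a far point [b] is a constant
    plus a nonnegative combination of the kernels [(1 - u^2 / b)^n], which as
    [b] tends to infinity are as good as the psd kernels [(1 + u^2 / b)^-n]. *)

Require Import Defs.
From HB Require Import structures.
From mathcomp Require Import all_boot all_order all_algebra.
From mathcomp Require Import all_classical all_reals all_analysis.
From mathcomp Require Import measurable_realfun.
From mathcomp Require Import ring lra.
Import Order.TTheory GRing.Theory Num.Theory.
Import numFieldNormedType.Exports.
Local Open Scope classical_set_scope.
Local Open Scope ring_scope.

Set Implicit Arguments. Unset Strict Implicit. Unset Printing Implicit Defensive.

(** * Positive semidefinite and conditionally negative definite kernels *)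

Definition qform (R : realType) (I : finType) (K : I -> I -> R) (a : I -> R) : R :=
  \sum_i \sum_j a i * a j * K i j.

Definition psd (R : realType) (I : finType) (K : I -> I -> R) : Prop :=
  (forall i j, K i j = K j i) /\ (forall a, 0 <= qform K a).

Definition cnd (R : realType) (I : finType) (K : I -> I -> R) : Prop :=
  (forall i j, K i j = K j i) /\
  (forall a, \sum_i a i = 0 -> qform K a <= 0).

Section Kernels.
Variables (R : realType) (I : finType).
Implicit Types (K L : I -> I -> R) (a u : I -> R) (p : I) (c : R).

Lemma eq_qform K L a : (forall i j, K i j = L i j) -> qform K a = qform L a.
Proof.
by move=> KL; apply: eq_bigr => i _; apply: eq_bigr => j _; rewrite KL.
Qed.

Lemma eq_psd K L : (forall i j, K i j = L i j) -> psd K -> psd L.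
Proof.
move=> KL [Ks Kp]; split=> [i j|a]; first by rewrite -!KL.
by rewrite -(eq_qform a KL).
Qed.

Lemma eq_cnd K L : (forall i j, K i j = L i j) -> cnd K -> cnd L.
Proof.
move=> KL [Ks Kn]; split=> [i j|a a0]; first by rewrite -!KL.
by rewrite -(eq_qform a KL) Kn.
Qed.

Lemma qformD K L a : qform (fun i j => K i j + L i j) a = qform K a + qform L a.
Proof.
rewrite -big_split; apply: eq_bigr => i _ /=; rewrite -big_split.
by apply: eq_bigr => j _ /=; rewrite mulrDr.
Qed.

Lemma qformZ c K a : qform (fun i j => c * K i j) a = c * qform K a.
Proof.
rewrite /qform mulr_sumr; apply: eq_bigr => i _; rewrite mulr_sumr.
by apply: eq_bigr => j _; rewrite mulrCA.
Qed.

Lemma qform_sum n (w : nat -> R) (K : nat -> I -> I -> R) a :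
  qform (fun i j => \sum_(k < n) w k * K k i j) a =
  \sum_(k < n) w k * qform (K k) a.
Proof.
elim: n => [|n IH].
  by rewrite big_ord0 /qform big1 // => i _; rewrite big1 // => j _;
    rewrite big_ord0 mulr0.
rewrite big_ord_recr /= -IH -qformZ -qformD; apply: eq_qform => i j.
by rewrite big_ord_recr.
Qed.

Lemma qform_rank1 u a : qform (fun i j => u i * u j) a = (\sum_i a i * u i) ^+ 2.
Proof.
rewrite expr2 mulr_suml; apply: eq_bigr => i _; rewrite mulr_sumr.
by apply: eq_bigr => j _; ring.
Qed.

Lemma qform_scale u K a :
  qform (fun i j => u i * u j * K i j) a = qform K (fun i => a i * u i).
Proof. by apply: eq_bigr => i _; apply: eq_bigr => j _; ring. Qed.

Lemma sum_delta p (f : I -> R) : \sum_i (i == p)%:R * f i = f p.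
Proof.
rewrite (bigD1 p) //= eqxx mul1r big1 ?addr0 // => i /negPf ->.
by rewrite mul0r.
Qed.

(** Perturbing [a] at one point serves twice: nonnegativity for all [x] and [t] yields a
    Cauchy-Schwarz inequality, and [t = - \sum_i a i] moves a vector into the sum-zero
    hyperplane. *)
Lemma qform_add_delta K a p x t : (forall i j, K i j = K j i) ->
  qform K (fun i => x * a i + t * (i == p)%:R) =
  x ^+ 2 * qform K a + x * t *+ 2 * (\sum_i a i * K i p) + t ^+ 2 * K p p.
Proof.
move=> Ks.
rewrite /qform (eq_bigr (fun i => x ^+ 2 * (\sum_j a i * a j * K i j)
   + x * t * (a i * K i p)
   + (i == p)%:R * (x * t * (\sum_j a j * K j i) + t ^+ 2 * K i p))) => [|i _].
  rewrite !big_split /= sum_delta -!mulr_sumr; ring.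
rewrite (eq_bigr (fun j => x ^+ 2 * (a i * a j * K i j)
   + (i == p)%:R * x * t * (a j * K j i)
   + (j == p)%:R * (x * t * (a i * K i j) + (i == p)%:R * t ^+ 2 * K i j)))
  => [|j _]; last by rewrite (Ks j i); ring.
rewrite !big_split /= sum_delta -!mulr_sumr; ring.
Qed.

(** * Closure properties of positive semidefinite kernels *)

Lemma psd_diag_ge0 K p : psd K -> 0 <= K p p.
Proof.
move=> [Ks Kp]; have := Kp (fun i => 0 * (fun=> 0) i + 1 * (i == p)%:R).
by rewrite qform_add_delta //; congr (_ <= _); ring.
Qed.

Lemma psdD K L : psd K -> psd L -> psd (fun i j => K i j + L i j).
Proof.
move=> [Ks Kp] [Ls Lp]; split=> [i j|a]; first by rewrite Ks Ls.
by rewrite qformD addr_ge0.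
Qed.

Lemma psdZ c K : 0 <= c -> psd K -> psd (fun i j => c * K i j).
Proof.
move=> c0 [Ks Kp]; split=> [i j|a]; first by rewrite Ks.
by rewrite qformZ mulr_ge0.
Qed.

Lemma psd_rank1 u : psd (fun i j => u i * u j).
Proof. by split=> [i j|a]; rewrite ?qform_rank1 ?sqr_ge0 // mulrC. Qed.

Lemma psd_scale u K : psd K -> psd (fun i j => u i * u j * K i j).
Proof.
move=> [Ks Kp]; split=> [i j|a]; first by rewrite Ks (mulrC (u i)).
by rewrite qform_scale.
Qed.

Lemma psd_const c : 0 <= c -> psd (fun _ _ : I => c).
Proof.
move=> c0; apply: (@eq_psd (fun i j => c * (1 * 1))) => [i j|]; first by ring.
exact/(psdZ c0)/(psd_rank1 (fun=> 1)).
Qed.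

Lemma psd_sum (J : Type) (r : seq J) (K : J -> I -> I -> R) :
  (forall k, psd (K k)) -> psd (fun i j => \sum_(k <- r) K k i j).
Proof.
move=> Kp; elim: r => [|k r IH].
  by apply: (@eq_psd (fun _ _ => 0)) => [i j|]; [rewrite big_nil|exact: psd_const].
apply: (@eq_psd (fun i j => K k i j + \sum_(k <- r) K k i j)) => [i j|].
  by rewrite big_cons.
exact: psdD.
Qed.

(** This is [K p p] times the Schur complement of the entry at [p], with the denominator cleared so
    that [K p p = 0] is allowed. Nonnegativity is Cauchy-Schwarz for [a] and the delta at [p]. *)
Lemma psd_deflate K p : psd K -> psd (fun i j => K p p * K i j - K i p * K j p).
Proof.
move=> Kpsd; have [Ks Kp] := Kpsd; split=> [i j|a].
  by rewrite Ks (mulrC (K i p)).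
rewrite (@eq_qform _ (fun i j => K p p * K i j + (-1) * (K i p * K j p)))
  => [|i j]; last by ring.
rewrite qformD !qformZ (qform_rank1 (fun i => K i p)) mulN1r subr_ge0.
set s := \sum_i _; set q := qform K a.
have Q x t : 0 <= x ^+ 2 * q + x * t *+ 2 * s + t ^+ 2 * K p p.
  by rewrite -qform_add_delta.
have := psd_diag_ge0 p Kpsd; rewrite le_eqVlt => /orP[/eqP Kpp|Kpp].
  rewrite -Kpp mul0r.
  have [->|s0] := eqVneq s 0; first by rewrite expr0n.
  (* With [K p p = 0] and [x = 1] the form is affine in [t]; if [s != 0], this [t] brings it down to
     [-1]. *)
  have := Q 1 (- (q + 1) / (2 * s)); rewrite -Kpp mulr0 addr0.
  have -> : 1 ^+ 2 * q + 1 * (- (q + 1) / (2 * s)) *+ 2 * s = -1 by field.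
  by rewrite ler0N1.
(* The minimiser [t / x = - s / K p p], rescaled to avoid division. *)
have := Q (K p p) (- s).
have -> : K p p ^+ 2 * q + K p p * - s *+ 2 * s + (- s) ^+ 2 * K p p
  = K p p * (K p p * q - s ^+ 2) by ring.
by rewrite pmulr_rge0 // subr_ge0.
Qed.

(** The difference is the diagonal entry at [i] of the kernel deflated at [j]. Bounds on the
    diagonal thereby control all entries. *)
Lemma psd_minor K i j : psd K -> K i j ^+ 2 <= K i i * K j j.
Proof.
move=> Kpsd; have := psd_diag_ge0 i (psd_deflate j Kpsd).
by rewrite /= subr_ge0 expr2 (mulrC (K i i)).
Qed.

(* Induction on the number of nonzero diagonal entries of [K]: subtracting the
   rank one kernel [K i p * K j p / K p p] kills the row [p]. *)
Lemma psdM K L : psd K -> psd L -> psd (fun i j => K i j * L i j).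
Proof.
move=> + Lpsd; have [n] := ubnP #|[pred i | K i i != 0]|; elim: n K => // n IH K.
rewrite ltnS => cardK Kpsd.
have [p|K0] := pickP [pred i | K i i != 0]; last first.
  apply: (@eq_psd (fun _ _ => 0)) => [i j|]; last exact: psd_const.
  have /eqP Kii := negbFE (K0 i).
  have := psd_minor i j Kpsd; rewrite Kii mul0r => Kij.
  have : K i j ^+ 2 == 0 by rewrite eq_le Kij sqr_ge0.
  by rewrite sqrf_eq0 => /eqP ->; rewrite mul0r.
rewrite /= => Kpp.
have Kpp0 : 0 < K p p by rewrite lt_def Kpp psd_diag_ge0.
pose E i j := (K p p)^-1 * (K p p * K i j - K i p * K j p).
have Epsd : psd E by apply: psdZ; rewrite ?invr_ge0 ?ltW //; exact: psd_deflate.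
apply: (@eq_psd (fun i j => E i j * L i j
   + (K p p)^-1 * (K i p * K j p * L i j))) => [i j|].
  by rewrite /E; field.
apply: psdD; last first.
  apply: psdZ; first by rewrite invr_ge0 ltW.
  exact: psd_scale.
apply: IH => //; apply: leq_trans cardK; apply: proper_card.
apply/properP; split; last first.
  exists p; first by rewrite inE.
  by rewrite inE negbK /E; apply/eqP; ring.
(* A zero diagonal entry of [K] has a zero row by the minors, so it stays zero in [E]. *)
apply/fintype.subsetP => i; rewrite !inE; apply: contra => /eqP Kii.
have := psd_minor i p Kpsd; rewrite Kii mul0r => Kip.
have : K i p ^+ 2 == 0 by rewrite eq_le Kip sqr_ge0.
rewrite sqrf_eq0 => /eqP Kip0; rewrite /E Kii Kip0; apply/eqP; ring.
Qed.

Lemma psdX K n : psd K -> psd (fun i j => K i j ^+ n).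
Proof.
move=> Kpsd; elim: n => [|n IH].
  by apply: (@eq_psd (fun _ _ => 1)) => [i j|]; [rewrite expr0|exact: psd_const].
by apply: (@eq_psd (fun i j => K i j * K i j ^+ n)) => [i j|];
  [rewrite exprS|exact: psdM].
Qed.

Lemma cvg_qform (T : Type) (F : set_system T) {FF : Filter F}
    (G : T -> I -> I -> R) L a :
  (forall i j, G x i j @[x --> F] --> L i j) ->
  qform (G x) a @[x --> F] --> qform L a.
Proof.
have addC : continuous (fun x : R * R => x.1 + x.2) by exact: add_continuous.
move=> FL; apply: (cvg_big addC) => i _; apply: (cvg_big addC) => j _.
by apply: cvgMr; exact: FL.
Qed.

Lemma psd_lim (T : Type) (F : set_system T) {FF : ProperFilter F}
    (G : T -> I -> I -> R) L :
  (\forall x \near F, psd (G x)) ->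
  (forall i j, G x i j @[x --> F] --> L i j) -> psd L.
Proof.
move=> Gp GL; split=> [i j|a].
  have := GL j i; apply: cvg_unique => //; apply: cvg_trans (GL i j).
  by apply: near_eq_cvg; apply: filterS Gp => x [->].
have Ga : qform (G x) a @[x --> F] --> qform L a by exact: cvg_qform.
rewrite -(cvg_lim (@Rhausdorff R) Ga).
apply: limr_ge; first exact: (cvgP _ Ga).
by apply: filterS Gp => x [_ /(_ a)].
Qed.

(** Partial sums of the geometric series are psd by the Schur product. The minors turn the diagonal
    bound into [|K i j| < 1], so every entry converges. *)
Lemma psd_inv1B K : psd K -> (forall i, K i i < 1) ->
  psd (fun i j => (1 - K i j)^-1).
Proof.
move=> Kpsd K1.
apply: (@psd_lim _ \oo _ (fun n i j => series (geometric 1 (K i j)) n)) => [|i j].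
  apply: nearW => n.
  apply: (@eq_psd (fun i j => \sum_(k <- index_iota 0 n) K i j ^+ k)) => [i j|].
    by apply: eq_bigr => k _; rewrite /= mul1r.
  by apply: psd_sum => k; exact: psdX.
rewrite -[_^-1]mul1r; apply: cvg_geometric_series.
rewrite -sqrtr_sqr -[ltRHS]sqrtr1 ltr_sqrt // (le_lt_trans (psd_minor i j Kpsd))//.
by rewrite mulr_ilt1 ?psd_diag_ge0.
Qed.

(** * Conditionally negative definite kernels and their entrywise inverses *)

Lemma cnd_base K p : cnd K -> 0 <= K p p ->
  psd (fun i j => K i p * K j p - K p p * K i j).
Proof.
move=> [Ks Kp] Kpp; split=> [i j|a]; first by rewrite (Ks i j) (mulrC (K i p)).
rewrite (@eq_qform _ (fun i j => K i p * K j p + (- K p p) * K i j))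
  => [|i j]; last by ring.
rewrite qformD qformZ (qform_rank1 (fun i => K i p)).
(* Mass [- \sum_i a i] at [p] makes the vector sum to zero. The claim follows from [K p p] times the
   resulting inequality and the square of [s - t * K p p]. *)
have := Kp (fun i => 1 * a i + (- \sum_i a i) * (i == p)%:R).
rewrite (qform_add_delta a) // => Kneg.
set s := \sum_i a i * K i p in Kneg *; set t := \sum_i a i in Kneg *.
set q := qform K a in Kneg *.
have {}/Kneg : \sum_i (1 * a i + - t * (i == p)%:R) = 0.
  rewrite big_split /= -mulr_sumr -mulr_sumr mul1r.
  under [X in _ + _ * X]eq_bigr do rewrite -[_%:R]mulr1.
  by rewrite sum_delta mulr1 subrr.
move=> /(mulr_ge0_le0 Kpp); have := sqr_ge0 (s - t * K p p); lra.
Qed.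

Lemma cnd_inv K : cnd K -> (forall i j, 0 < K i j) -> psd (fun i j => (K i j)^-1).
Proof.
move=> Kcnd K0; have Ks := Kcnd.1.
have [p _|I0] := pickP (@predT I); last first.
  by split=> [i|a]; [have := I0 i|rewrite /qform big_pred0].
have n0 i j : K i j != 0 by rewrite gt_eqF.
pose c i j := (K i p)^-1 * (K j p)^-1 * (K i p * K j p - K p p * K i j).
have cpsd : psd c.
  by apply: (psd_scale (fun i => (K i p)^-1)); apply: cnd_base => //; exact: ltW.
(* So [1 - c] is [K] up to a positive factor and a diagonal scaling, which are undone at the end;
   its positive diagonal gives [c i i < 1]. *)
have cE i j : 1 - c i j = K p p * (K i j) / (K i p * K j p).
  by rewrite /c; field; rewrite !n0.
have := psd_inv1B cpsd; have : forall i, c i i < 1.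
  by move=> i; rewrite -subr_gt0 cE divr_gt0 ?mulr_gt0.
move=> c1 /(_ c1) /(psd_scale (fun i => (K i p)^-1)) /(psdZ (ltW (K0 p p))).
by apply: eq_psd => i j; rewrite cE; field; rewrite !n0.
Qed.

Lemma cndD K L : cnd K -> cnd L -> cnd (fun i j => K i j + L i j).
Proof.
move=> [Ks Kn] [Ls Ln]; split=> [i j|a a0]; first by rewrite Ks Ls.
by rewrite qformD -[leRHS]addr0 lerD ?Kn ?Ln.
Qed.

Lemma cndZ c K : 0 <= c -> cnd K -> cnd (fun i j => c * K i j).
Proof.
move=> c0 [Ks Kn]; split=> [i j|a a0]; first by rewrite Ks.
by rewrite qformZ mulr_ge0_le0 ?Kn.
Qed.

Lemma qform_const c a : qform (fun _ _ => c) a = c * (\sum_i a i) ^+ 2.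
Proof.
rewrite (@eq_qform _ (fun i j => c * (1 * 1))) => [|i j]; last by ring.
rewrite qformZ (qform_rank1 (fun=> 1)).
by under eq_bigr do rewrite mulr1.
Qed.

Lemma cnd_const c : cnd (fun _ _ : I => c).
Proof. by split=> // a a0; rewrite qform_const a0 expr0n mulr0. Qed.

(** On sum-zero vectors the terms depending on one index vanish, which leaves
    [-2 * (\sum_i a i * u i) ^+ 2]. *)
Lemma cnd_sqr_dist u : cnd (fun i j => (u i - u j) ^+ 2).
Proof.
split=> [i j|a a0]; first by ring.
rewrite (@eq_qform _ (fun i j => u i ^+ 2 * 1 + ((-2) * (u i * u j) + 1 * u j ^+ 2)))
  => [|i j]; last by ring.
rewrite !qformD (qformZ (-2) (fun i j => u i * u j)) (qform_rank1 u).
have -> : qform (fun i j => u i ^+ 2 * 1) a = 0.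
  rewrite /qform big1 // => i _.
  by under eq_bigr do rewrite mulr1 mulrAC; rewrite -mulr_sumr a0 mulr0.
have -> : qform (fun i j => 1 * u j ^+ 2) a = 0.
  rewrite /qform exchange_big big1 //= => j _.
  under eq_bigr do rewrite mul1r -mulrA; by rewrite -mulr_suml a0 mul0r.
have := sqr_ge0 (\sum_i a i * u i); lra.
Qed.

(* [z = 1 - sqrt (1 - x)] solves [z = (x + z^2) / 2]; the iterates are
   polynomials in [x] with nonnegative coefficients. *)
Definition sqrt_iter (x : R) (n : nat) : R :=
  iter n (fun z => (x + z ^+ 2) / 2) 0.

Lemma cvg_sqrt_iter (x : R) : 0 <= x < 1 ->
  sqrt_iter x n @[n --> \oo] --> 1 - Num.sqrt (1 - x).
Proof.
move=> /andP[x0 x1]; set z := 1 - _.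
have r0 : 0 < Num.sqrt (1 - x) by rewrite sqrtr_gt0 subr_gt0.
have r1 : Num.sqrt (1 - x) <= 1 by rewrite -[leRHS]sqrtr1 ler_sqrt //; lra.
have zE : z ^+ 2 = 2 * z - x.
  have : Num.sqrt (1 - x) ^+ 2 = 1 - x by rewrite sqr_sqrtr // subr_ge0 ltW.
  by rewrite /z; move: (Num.sqrt _) => r rE; ring: rE.
have z0 : 0 <= z by rewrite subr_ge0.
have z1 : z < 1 by rewrite /z; lra.
(* As [z] is a fixed point, one step from [w <= z] multiplies the error by [(z + w) / 2 <= z], and
   [z < 1]. *)
have B n : 0 <= sqrt_iter x n <= z /\ z - sqrt_iter x n <= z ^+ n.
  elim: n => [|n [/andP[w0 wz] wn]].
    by rewrite /sqrt_iter /= z0 lexx subr0 expr0 ltW.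
  rewrite /sqrt_iter iterS -/(sqrt_iter x n); move: (sqrt_iter x n) w0 wz wn => w w0 wz wn.
  have dE : z - (x + w ^+ 2) / 2 = (z - w) * (z + w) / 2 by lra.
  have : (z - w) * (z + w) / 2 <= z ^+ n * z.
    by rewrite -mulrA; apply: ler_pM => //; lra.
  rewrite -dE -exprSr; split=> //; apply/andP; split; first nra.
  by rewrite -subr_ge0 dE; apply: divr_ge0 => //; nra.
apply: (@squeeze_cvgr _ _ _ _ (fun n => z - z ^+ n) (fun=> z)).
- by apply: nearW => n; have [/andP[? ?] ?] := B n; apply/andP; split=> //; lra.
- rewrite -[X in _ --> X]subr0; apply: cvgB; first exact: cvg_cst.
  by apply: cvg_expr; rewrite ger0_norm.
- exact: cvg_cst.
Qed.

(** The kernel [1 - sqrt (1 - K)] is a limit of psd polynomials in [K], with diagonal below [1]; the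
    geometric series then inverts one minus it. *)
Lemma psd_sqrt_inv K : psd K -> (forall i j, 0 <= K i j < 1) ->
  psd (fun i j => (Num.sqrt (1 - K i j))^-1).
Proof.
move=> Kpsd K01.
have : psd (fun i j => 1 - Num.sqrt (1 - K i j)).
  apply: (@psd_lim _ \oo _ (fun n i j => sqrt_iter (K i j) n)) => [|i j].
    apply: nearW; elim=> [|n IH]; first exact: psd_const.
    apply: (@eq_psd (fun i j => 2^-1 * (K i j + sqrt_iter (K i j) n ^+ 2))) => [i j|].
      by rewrite mulrC.
    by apply: psdZ; rewrite ?invr_ge0 //; apply: psdD => //; exact: psdX.
  exact: cvg_sqrt_iter.
move/psd_inv1B => H; apply: eq_psd (H _) => [i j|i]; first by rewrite subKr.
have /andP[_ K1] := K01 i i.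
by rewrite ltrBlDr ltrDl sqrtr_gt0 subr_gt0.
Qed.

End Kernels.

(** * The great circle distance *)

Section AcosCnd.
Variable R : realType.

(** Meant for [acos] on [[-1, 1]] and [psi] on [[0, +oo[], whose continuity is relative to the
    domain while limits may fall on its boundary. *)
Lemma cvg_within_comp (U V : topologicalType) (A : set U) (g : U -> V)
    (T : Type) (F : set_system T) {FF : Filter F} (h : T -> U) (y : U) :
  {within A, continuous g} -> A y -> h x @[x --> F] --> y ->
  (\forall x \near F, A (h x)) -> g (h x) @[x --> F] --> g y.
Proof.
move=> /subspace_continuousP/(_ y) gA /gA gy hy Ah.
apply: (cvg_comp _ _ _ gy) => W /hy; rewrite /nbhs /=; apply: filterS2 Ah.
by move=> x Ax; apply.
Qed.

Lemma le_is_derive (f df : R -> R) (a b : R) : a <= b ->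
  (forall x, a <= x <= b -> is_derive x 1 f (df x)) ->
  (forall x, a <= x <= b -> 0 <= df x) -> f a <= f b.
Proof.
move=> ab fdf df0.
have sub x : x \in `]a, b[ -> a <= x <= b.
  by rewrite in_itv /= => /andP[/ltW -> /ltW ->].
apply: (@ger0_derive1_ndecr _ f a b) => // [x /sub xab|x /sub xab|].
- by have := fdf _ xab => -[].
- by rewrite derive1E; have := fdf _ xab => -[_ ->]; exact: df0.
apply: derivable_within_continuous => x; rewrite in_itv /= => xab.
by have := fdf _ xab => -[].
Qed.

Lemma within_continuous_acos : {within `[(-1 : R), 1], continuous (@acos R)}.
Proof.
have cosC : {within `[0, pi], continuous (@cos R)}.
  exact/continuous_subspaceT/continuous_cos.
have N11 : (-1 : R) <= 1 by lra.
have := segment_can_continuous (pi_ge0 R) cosC (@cosK R).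
by rewrite cos0 cospi (min_idPr N11) (max_idPl N11).
Qed.

Lemma cvg_acos_scale (x : R) : -1 <= x <= 1 ->
  acos (r * x) @[r --> 1^'-] --> acos x.
Proof.
move=> x1; apply: (cvg_within_comp within_continuous_acos).
- by rewrite /= in_itv.
- by rewrite -[X in _ --> X]mul1r; apply: cvgMl; exact: cvg_at_left_filter.
near=> r; rewrite /= in_itv /= -ler_norml normrM mulr_ile1 ?ler_norml //.
apply/andP; split; last by near: r; exact: nbhs_left_le.
by near: r; apply: nbhs_left_ge; lra.
Unshelve. all: by end_near.
Qed.

Lemma is_derive_bigsum (J : Type) (s : seq J) (F : J -> R -> R) (dF : J -> R) (x : R) :
  (forall j, is_derive x 1 (F j) (dF j)) ->
  is_derive x 1 (fun t => \sum_(j <- s) F j t) (\sum_(j <- s) dF j).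
Proof.
move=> dFx; elim: s => [|j s IH].
  rewrite big_nil (_ : (fun _ => _) = cst 0); first exact: is_derive_cst.
  by apply/funext => t; rewrite big_nil.
rewrite big_cons (_ : (fun _ => _) = F j \+ (fun t => \sum_(j <- s) F j t)).
  exact: is_deriveD.
by apply/funext => t; rewrite big_cons.
Qed.

Lemma is_derive_qform (I : finType) (F : R -> I -> I -> R) (dF : I -> I -> R)
    (a : I -> R) (x : R) :
  (forall i j, is_derive x 1 (fun t => F t i j) (dF i j)) ->
  is_derive x 1 (fun t => qform (F t) a) (qform dF a).
Proof.
by move=> dFx; apply: is_derive_bigsum => i; apply: is_derive_bigsum => j.
Qed.

Lemma cnd_acos (I : finType) (K : I -> I -> R) :
  psd K -> (forall i, K i i = 1) -> cnd (fun i j => acos (K i j)).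
Proof.
move=> Kpsd K1; have Ks := Kpsd.1.
have KB i j : -1 <= K i j <= 1.
  rewrite -ler_norml -sqrtr_sqr -[leRHS]sqrtr1 ler_sqrt //.
  by rewrite (le_trans (psd_minor i j Kpsd)) // !K1 mulr1.
split=> [i j|a a0]; first by rewrite Ks.
(* For [0 <= r < 1] the arguments stay in []-1, 1[], where [acos] is differentiable. [Q] vanishes at
   [0], does not increase, and tends to the required form as [r] tends to [1] from the left. *)
pose Q (r : R) := qform (fun i j => acos (r * K i j)) a.
have rB r i j : 0 <= r < 1 -> -1 < r * K i j < 1.
  move=> /andP[r0 r1]; rewrite -ltr_norml normrM (ger0_norm r0).
  have : `|K i j| <= 1 by rewrite ler_norml.
  nra.
have Qd (r : R) : 0 <= r < 1 -> is_derive r 1 Q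
    (qform (fun i j => - (Num.sqrt (1 - (r * K i j) ^+ 2))^-1 * K i j) a).
  move=> r01; apply: is_derive_qform => i j.
  have dr : is_derive r 1 ( *%R^~ (K i j)) (K i j).
    rewrite (_ : *%R^~ (K i j) = (K i j) \*: id); last first.
      by apply/funext => t; rewrite /= mulrC.
    by rewrite -[X in is_derive _ _ _ X]mulr1; apply: is_deriveZ.
  apply: (@is_derive1_comp _ (@acos R) ( *%R^~ (K i j))); exact: is_derive1_acos (rB _ _ _ r01).
have Q0 : Q 0 = 0.
  rewrite /Q (@eq_qform _ _ _ (fun _ _ => acos 0)) => [|i j]; last by rewrite mul0r.
  by rewrite qform_const a0 expr0n mulr0.
have Qle r : 0 <= r < 1 -> Q r <= 0.
  move=> /andP[r0 r1]; rewrite -Q0.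
  pose dQ x := qform (fun i j => (Num.sqrt (1 - (x * K i j) ^+ 2))^-1 * K i j) a.
  rewrite -lerN2; apply: (@le_is_derive (fun x => - Q x) dQ) => // x /andP[x0 xr].
    have -> : dQ x = - (-1 * dQ x) by rewrite mulN1r opprK.
    rewrite -qformZ; apply: is_deriveN.
    rewrite (@eq_qform _ _ _ (fun i j => - (Num.sqrt (1 - (x * K i j) ^+ 2))^-1 * K i j)).
      by apply: Qd; rewrite x0 (le_lt_trans xr).
    by move=> i j; rewrite mulN1r mulNr.
  suff [_ ->] : psd (fun i j => (Num.sqrt (1 - (x * K i j) ^+ 2))^-1 * K i j) by [].
  apply: psdM => //; apply: psd_sqrt_inv => [|i j].
    apply: (@eq_psd _ _ (fun i j => x ^+ 2 * K i j ^+ 2)) => [i j|].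
      by rewrite exprMn.
    by apply: psdZ; [exact: sqr_ge0|exact: psdX].
  rewrite sqr_ge0 /=.
  have /(rB _ i j)/andP[] : 0 <= x < 1 by rewrite x0 (le_lt_trans xr).
  nra.
have Qcvg : Q r @[r --> 1^'-] --> qform (fun i j => acos (K i j)) a.
  by apply: cvg_qform => i j; exact: cvg_acos_scale.
rewrite -(cvg_lim (@Rhausdorff R) Qcvg).
apply: limr_le; first exact: (cvgP _ Qcvg).
near=> r; apply: Qle; apply/andP; split; last by near: r; exact: nbhs_left_lt.
by near: r; apply: nbhs_left_ge.
Unshelve. all: by end_near.
Qed.

End AcosCnd.

(** * Bernstein functions of conditionally negative definite kernels *)

(* [P n] stands for the [n]-th derivative of an absolutely monotone function. *)
Section AbsolutelyMonotone.
Variables (R : realType) (T : R) (P : nat -> R -> R).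
Hypothesis derP : forall n t, t < T -> is_derive t 1 (P n) (P n.+1 t).
Hypothesis P_ge0 : forall n t, 0 <= t < T -> 0 <= P n t.

Definition taylor_rem (N j : nat) (t : R) : R :=
  P j t - \sum_(n < N) P (j + n)%N 0 * (t ^+ n / n`!%:R).

Lemma taylor_rem0 N j : taylor_rem N.+1 j 0 = 0.
Proof.
rewrite /taylor_rem big_ord_recl addn0 expr0 fact0 divr1 mulr1 big1 ?addr0 ?subrr //.
by move=> i _; rewrite lift0 exprS !mul0r mulr0.
Qed.

(** Differentiation lowers the order and raises the index, so the inductions on [N] below keep [j]
    general. *)
Lemma is_derive_taylor_rem N j t : t < T ->
  is_derive t 1 (taylor_rem N.+1 j) (taylor_rem N j.+1 t).
Proof.
move=> tT; have term n : is_derive t 1 (fun t => t ^+ n.+1 / n.+1`!%:R)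
    (t ^+ n / n`!%:R).
  have : is_derive t 1 ((n.+1`!%:R)^-1 \*: (@id R ^+ n.+1))
     ((n.+1`!%:R)^-1 *: ((n.+1%:R * t ^+ n) *: 1)).
    apply: is_deriveZ; exact: is_deriveX.
  congr is_derive.
    by apply/funext => s; rewrite /= fctE mulrC.
  rewrite /GRing.scale /= factS natrM mulr1.
  have : n.+1%:R != 0 :> R by rewrite pnatr_eq0.
  have : n`!%:R != 0 :> R by rewrite pnatr_eq0 -lt0n fact_gt0.
  by move: n`!%:R n.+1%:R => x y x0 y0; field; rewrite x0.
rewrite (_ : taylor_rem N.+1 j = (P j) - (fun s => \sum_(n < N.+1)
    P (j + n)%N 0 * (s ^+ n / n`!%:R))); last by [].
apply: is_deriveB; first exact: derP.
rewrite (_ : (fun _ => _) = (fun s => P j 0 + \sum_(n < N)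
    P (j.+1 + n)%N 0 * (s ^+ n.+1 / n.+1`!%:R))); last first.
  apply/funext => s; rewrite big_ord_recl addn0 expr0 fact0 divr1 mulr1.
  by congr (_ + _); apply: eq_bigr => n _; rewrite lift0 addSnnS.
rewrite -[X in is_derive _ _ _ X]add0r; apply: is_deriveD.
by apply: is_derive_bigsum => n; apply: is_deriveZ.
Qed.

(** The remainder vanishes at [0] and its derivative is a remainder of lower order, nonnegative by
    induction. *)
Lemma taylor_rem_ge0 N j t : 0 <= t < T -> 0 <= taylor_rem N j t.
Proof.
elim: N j t => [|N IH] j t /andP[t0 tT].
  by rewrite /taylor_rem big_ord0 subr0 P_ge0 // t0.
rewrite -(taylor_rem0 N j).
apply: (@le_is_derive _ _ (taylor_rem N j.+1)) => // x /andP[x0 xt].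
  by apply: is_derive_taylor_rem; rewrite (le_lt_trans xt).
by apply: IH; rewrite x0 (le_lt_trans xt).
Qed.

(* With [l < 1] this makes the Taylor series of [P j] converge. *)
Lemma taylor_rem_scale N j (l t : R) : 0 <= l <= 1 -> 0 <= t < T ->
  taylor_rem N j (l * t) <= l ^+ N * taylor_rem N j t.
Proof.
move=> /andP[l0 l1]; elim: N j t => [|N IH] j t /andP[t0 tT].
  rewrite /taylor_rem !big_ord0 !subr0 expr0 mul1r.
  apply: (@le_is_derive _ _ (P j.+1)) => [|x /andP[x0 xt]|x /andP[x0 xt]].
  - by rewrite ler_piMl.
  - by apply: derP; rewrite (le_lt_trans xt).
  by apply: P_ge0; rewrite (le_trans (mulr_ge0 l0 t0)) ?(le_lt_trans xt).
(* [f] vanishes at [0], and [df] is [l] times the gap in the induction hypothesis; the chain rule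
   supplies the extra power of [l]. *)
pose f x := l ^+ N.+1 * taylor_rem N.+1 j x - taylor_rem N.+1 j (l * x).
pose df x := l * (l ^+ N * taylor_rem N j.+1 x - taylor_rem N j.+1 (l * x)).
have lxT x : 0 <= x <= t -> l * x < T.
  by move=> /andP[x0 xt]; rewrite (le_lt_trans _ tT) // (le_trans _ xt) // ler_piMl.
rewrite -subr_ge0 -/(f t).
have <- : f 0 = 0 by rewrite /f mulr0 taylor_rem0 mulr0 subrr.
apply: (@le_is_derive _ f df) => // x xt; have lx := lxT _ xt;
  have /andP[x0 xt'] := xt; have xT := le_lt_trans xt' tT; last first.
  by apply: mulr_ge0 => //; rewrite subr_ge0; apply: IH; rewrite x0.
have dl : is_derive x 1 ( *%R l) l.
  by rewrite -[X in is_derive _ _ _ X]mulr1; apply: (@is_deriveZ _ _ _ id).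
have d1 := is_deriveZ (l ^+ N.+1) (is_derive_taylor_rem N j xT).
have d2 := is_derive1_comp (is_derive_taylor_rem N j lx) dl.
have := is_deriveB d1 d2; congr is_derive.
by rewrite /df /GRing.scale /= exprS; ring.
Qed.

End AbsolutelyMonotone.

Lemma ler_subX (R : realType) (x y : R) n : 0 <= x -> x <= y -> y <= 1 ->
  y ^+ n - x ^+ n <= n%:R * (y - x).
Proof.
move=> x0 xy y1; elim: n => [|n IH]; first by rewrite !expr0 subrr mul0r.
have -> : y ^+ n.+1 - x ^+ n.+1 = y * (y ^+ n - x ^+ n) + (y - x) * x ^+ n.
  by rewrite !exprS; ring.
have -> : n.+1%:R * (y - x) = n%:R * (y - x) + (y - x) by rewrite -natr1; ring.
apply: lerD.
  apply: le_trans IH; rewrite ler_piMl // subr_ge0.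
  by rewrite lerXn2r // nnegrE // (le_trans x0).
by rewrite ler_piMr ?subr_ge0 // exprn_ile1 // (le_trans xy).
Qed.

Lemma qform_le_norm (R : realType) (I : finType) (K : I -> I -> R) (a : I -> R) c :
  (forall i j, `|K i j| <= c) ->
  `|qform K a| <= (\sum_i \sum_j `|a i * a j|) * c.
Proof.
move=> Kc; apply: le_trans (ler_norm_sum _ _ _) _; rewrite mulr_suml.
apply: ler_sum => i _; apply: le_trans (ler_norm_sum _ _ _) _; rewrite mulr_suml.
by apply: ler_sum => j _; rewrite normrM ler_wpM2l.
Qed.

(* [g n] stands for [(-1)^(n+1) psi^(n)], where [psi] is a Bernstein function. *)
Section BernsteinCnd.
Variables (R : realType) (g : nat -> R -> R).
Hypothesis derg : forall n (x : R), 0 < x -> is_derive x 1 (g n) (- g n.+1 x).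
Hypothesis g_ge0 : forall n (x : R), 0 < x -> 0 <= g n.+1 x.

(** Reflection cancels the alternating sign: [g n (c - t)] has derivative [g n.+1 (c - t)] in [t],
    as an absolutely monotone function requires. *)
Lemma is_derive_reflect (f : R -> R) (df c t : R) :
  is_derive (c - t) 1 f df -> is_derive t 1 (fun s => f (c - s)) (- df).
Proof.
move=> fd; have d : is_derive t 1 (fun s => c - s) (-1).
  by rewrite -[X in is_derive _ _ _ X]add0r; apply: is_deriveB.
by have := @is_derive1_comp _ f (fun s => c - s) t df (-1) fd d; rewrite mulrN1.
Qed.

(* The Taylor expansion of [g 0] at [b + e] is a nonnegative combination of the
   kernels [(1 - D / b) ^ n], [n > 0]; the kernel [(1 + D / b)^-1 ^ n] is
   positive semidefinite and within [n (D / b)^2] of it. *)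
Lemma bernstein_qform_ge (I : finType) (D : I -> I -> R) (a : I -> R) (e M b : R) :
  cnd D -> (forall i j, 0 <= D i j <= M) -> \sum_i a i = 0 ->
  0 < e -> 0 < M < b ->
  - ((\sum_i \sum_j `|a i * a j|) * (M ^+ 2 * g 1 e / b))
    <= qform (fun i j => g 0 (D i j + e)) a.
Proof.
move=> Dcnd DM a0 e0 /andP[M0 Mb]; have b0 := lt_trans M0 Mb.
set A := \sum_i _.
have A0 : 0 <= A by apply: sumr_ge0 => i _; apply: sumr_ge0.
(* No sign is known for [g 0]; subtracting its value at [b + e] makes [P 0] vanish at [0], hence
   nonnegative, and the constant is invisible to sum-zero vectors. *)
pose P n t := g n (b + e - t) - (n == 0)%:R * g 0 (b + e).
pose T := b + e.
have derP n t : t < T -> is_derive t 1 (P n) (P n.+1 t).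
  move=> tT; have bt0 : 0 < b + e - t by rewrite subr_gt0.
  have := is_deriveB (is_derive_reflect (derg n bt0))
    (is_derive_cst ((n == 0)%:R * g 0 (b + e)) t 1).
  by rewrite opprK subr0 /P mul0r subr0.
have PS n t : t < T -> 0 <= P n.+1 t.
  by move=> tT; rewrite /P mul0r subr0 g_ge0 // subr_gt0.
have P_ge0 n t : 0 <= t < T -> 0 <= P n t.
  case: n => [|n] /andP[t0 tT]; last exact: PS.
  have <- : P 0 0 = 0 by rewrite /P eqxx mul1r subr0 subrr.
  apply: (@le_is_derive _ _ (P 1)) => // x /andP[_ xt].
    by apply: derP; rewrite (le_lt_trans xt).
  by apply: PS; rewrite (le_lt_trans xt).
(* A point strictly between [b] and [T]: then [q < 1], and scaling from [t] bounds the remainder on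
   [[0, b]] by [q ^+ N * P 0 t]. *)
pose t := b + e / 2; pose q := b / t.
have t0 : 0 < t by rewrite /t; lra.
have tT : t < T by rewrite /t /T; lra.
have q01 : 0 <= q < 1.
  by rewrite divr_ge0 ?(ltW t0) ?(ltW b0) //= ltr_pdivrMr // mul1r /t; lra.
have remB N i j : `|taylor_rem P N 0 (b - D i j)| <= q ^+ N * P 0 t.
  have /andP[D0 DleM] := DM i j.
  have x0 : 0 <= b - D i j by lra.
  have xT : b - D i j < T by rewrite /T; lra.
  rewrite ger0_norm; last by apply: (taylor_rem_ge0 derP P_ge0); rewrite x0.
  pose l := (b - D i j) / t.
  have l0 : 0 <= l by rewrite divr_ge0 // ltW.
  have lq : l <= q by rewrite ler_pM2r ?invr_gt0 //; lra.
  have l1 : l <= 1 by case/andP: q01 => _ /ltW; exact: le_trans.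
  have -> : b - D i j = l * t by rewrite /l mulfVK // gt_eqF.
  have tt : 0 <= t < T by rewrite (ltW t0).
  apply: le_trans (taylor_rem_scale derP P_ge0 N 0 _ tt) _; first by rewrite l0.
  apply: ler_pM; rewrite ?exprn_ge0 ?(taylor_rem_ge0 derP P_ge0) //.
    by rewrite lerXn2r // nnegrE; case/andP: q01.
  rewrite /taylor_rem lerBlDr lerDl; apply: sumr_ge0 => n _.
  rewrite mulr_ge0 ?divr_ge0 ?exprn_ge0 ?(ltW t0) // P_ge0 // lexx /= /T; lra.
pose w n := P n 0 * (b ^+ n / n`!%:R).
have zT : 0 <= (0 : R) < T by rewrite lexx /= /T; lra.
have w0 n : 0 <= w n.
  by rewrite mulr_ge0 ?P_ge0 // divr_ge0 ?exprn_ge0 // ltW.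
pose d i j := D i j / b.
have d01 i j : 0 <= d i j <= M / b.
  have /andP[D0 DleM] := DM i j.
  by rewrite /d divr_ge0 ?(ltW b0) //= ler_pM2r ?invr_gt0.
have Mb1 : M / b < 1 by rewrite ltr_pdivrMr // mul1r.
(* The bases satisfy [(1 + d)^-1 - (1 - d) = d^2 / (1 + d) <= (M / b)^2], and taking powers costs a
   factor [n]. *)
have powB n : - (n%:R * (A * (M / b) ^+ 2)) <= qform (fun i j => (1 - d i j) ^+ n) a.
  have kpsd : psd (fun i j => ((1 + d i j)^-1) ^+ n).
    apply: psdX; apply: cnd_inv => [|i j]; last by case/andP: (d01 i j); lra.
    apply: cndD; first exact: cnd_const.
    apply: (@eq_cnd _ _ (fun i j => b^-1 * D i j)) => [i j|]; first by rewrite mulrC.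
    by apply: cndZ => //; rewrite invr_ge0 ltW.
  have := kpsd.2 a; set k := qform _ a => k0.
  rewrite (@eq_qform _ _ _ (fun i j => (1 + d i j)^-1 ^+ n +
    (-1) * ((1 + d i j)^-1 ^+ n - (1 - d i j) ^+ n))); last by move=> i j; ring.
  rewrite qformD qformZ mulN1r -/k.
  set h := qform _ a; have : `|h| <= A * (n%:R * (M / b) ^+ 2).
    apply: qform_le_norm => i j; have /andP[dge dle] := d01 i j.
    have d1 : 0 < 1 + d i j by lra.
    have vE : (1 + d i j)^-1 - (1 - d i j) = d i j ^+ 2 / (1 + d i j).
      by field; rewrite gt_eqF.
    have v0 : 0 <= (1 + d i j)^-1 - (1 - d i j).
      by rewrite vE divr_ge0 ?sqr_ge0 // ltW.
    have vd : (1 + d i j)^-1 - (1 - d i j) <= (M / b) ^+ 2.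
      rewrite vE; apply: le_trans (_ : d i j ^+ 2 <= _).
        by rewrite ler_pdivrMr // ler_peMr ?sqr_ge0 //; lra.
      by rewrite lerXn2r // nnegrE // (le_trans dge).
    have x0 : 0 <= 1 - d i j by lra.
    have xy : 1 - d i j <= (1 + d i j)^-1 by lra.
    have y1 : (1 + d i j)^-1 <= 1 by rewrite invf_le1 //; lra.
    rewrite ger0_norm; last first.
      by rewrite subr_ge0 lerXn2r // nnegrE // (le_trans x0).
    by apply: le_trans (ler_subX n x0 xy y1) _; rewrite ler_wpM2l.
  rewrite ler_norml => /andP[_ hle].
  have -> : n%:R * (A * (M / b) ^+ 2) = A * (n%:R * (M / b) ^+ 2) by ring.
  lra.
(* The sum is [b] times a Taylor polynomial of [P 1] at [b], whose remainder is nonnegative; the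
   term [n = 0] drops out, and [P 1 b = g 1 e]. *)
have sumw N : \sum_(n < N) w n * n%:R <= b * g 1 e.
  case: N => [|N]; first by rewrite big_ord0 mulr_ge0 ?g_ge0 // ltW.
  have bT : 0 <= b < T by rewrite (ltW b0) /= /T; lra.
  have P1b : P 1 b = g 1 e by rewrite /P mul0r subr0; congr (g 1 _); ring.
  have := taylor_rem_ge0 derP P_ge0 N 1 bT; rewrite /taylor_rem subr_ge0 P1b.
  move=> /(ler_wpM2l (ltW b0)); apply: le_trans.
  rewrite big_ord_recl mulr0 add0r mulr_sumr le_eqVlt; apply/orP; left; apply/eqP.
  apply: eq_bigr => n _; rewrite lift0 /w add1n factS natrM exprS.
  have : n.+1%:R != 0 :> R by rewrite pnatr_eq0.
  have : n`!%:R != 0 :> R by rewrite pnatr_eq0 -lt0n fact_gt0.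
  by move: n`!%:R n.+1%:R => x y x0 y0; field; rewrite x0.
(* The first error is [b * g 1 e] times [A * (M / b) ^+ 2]; the second comes from the remainder and
   vanishes as [N] grows. *)
have main N : - (A * (M ^+ 2 * g 1 e / b)) - A * P 0 t * q ^+ N
    <= qform (fun i j => g 0 (D i j + e)) a.
  have -> : qform (fun i j => g 0 (D i j + e)) a =
      \sum_(n < N) w n * qform (fun i j => (1 - d i j) ^+ n) a
      + qform (fun i j => taylor_rem P N 0 (b - D i j)) a.
    transitivity (qform (fun i j => g 0 (D i j + e) + (- g 0 (b + e))) a).
      by rewrite qformD qform_const a0 expr0n mulr0 addr0.
    rewrite -(qform_sum N w (fun n i j => (1 - d i j) ^+ n)) -qformD; apply: eq_qform => i j.
    rewrite /taylor_rem [RHS]addrC.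
    have -> : \sum_(n < N) P (0 + n)%N 0 * ((b - D i j) ^+ n / n`!%:R) =
        \sum_(n < N) w n * (1 - d i j) ^+ n.
      apply: eq_bigr => n _; rewrite (_ : b - D i j = b * (1 - d i j)).
        by rewrite exprMn /w add0n; ring.
      by rewrite /d; field; rewrite gt_eqF.
    by rewrite subrK /P eqxx mul1r; congr (g 0 _ - _); ring.
  have : `|qform (fun i j => taylor_rem P N 0 (b - D i j)) a| <= A * (q ^+ N * P 0 t).
    exact: qform_le_norm.
  rewrite ler_norml => /andP[+ _]; rewrite -!mulrA (mulrC (P 0 t)).
  apply: lerD.
  apply: le_trans (_ : \sum_(n < N) w n * - (n%:R * (A * (M / b) ^+ 2)) <= _).
    rewrite (_ : \sum_(n < N) _ = - ((\sum_(n < N) w n * n%:R) * (A * (M / b) ^+ 2))).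
      rewrite lerN2.
      have c0 : 0 <= A * (M / b) ^+ 2 by rewrite mulr_ge0 ?sqr_ge0.
      apply: le_trans (ler_wpM2r c0 (sumw N)) _.
      rewrite le_eqVlt; apply/orP; left; apply/eqP; field.
      by rewrite gt_eqF.
    move: (A * _) => c; rewrite mulr_suml -sumrN.
    by apply: eq_bigr => n _; ring.
  by apply: ler_sum => n _; rewrite ler_wpM2l.
have cv : - (A * (M ^+ 2 * g 1 e / b)) - A * P 0 t * q ^+ N @[N --> \oo] -->
    - (A * (M ^+ 2 * g 1 e / b)) - A * P 0 t * 0.
  apply: cvgB; first exact: cvg_cst.
  apply: cvgMr; apply: cvg_expr.
  by case/andP: q01 => q0 q1; rewrite ger0_norm.
rewrite mulr0 subr0 in cv; rewrite -(cvg_lim (@Rhausdorff R) cv).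
apply: limr_le; first exact: (cvgP _ cv).
by apply: nearW => N; exact: main.
Qed.

End BernsteinCnd.
(** For fixed [e > 0] the error in the lower bound is of order [1 / b], with [b] arbitrarily large.
    The shift [e] keeps arguments where derivatives exist; continuity removes it at the end. *)
Lemma cnd_bernstein (R : realType) (psi : R -> R) :
  {within `[0, +oo[, continuous psi} ->
  (forall x : R, 0 < x -> derivable psi x 1) ->
  completely_monotone (derive1 psi) ->
  forall (I : finType) (D : I -> I -> R),
  cnd D -> (forall i j, 0 <= D i j) -> cnd (fun i j => psi (D i j)).
Proof.
move=> psic psid [psid' psi_cm] I D Dcnd D0.
split=> [i j|a a0]; first by rewrite Dcnd.1.
pose g n x := (-1) ^+ n.+1 * derive1n n psi x.
have derS n x : derive1n n.+1 psi x = derive1n n (derive1 psi) x.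
  by rewrite /derive1n iterSr.
have derg n (x : R) : 0 < x -> is_derive x 1 (g n) (- g n.+1 x).
  move=> x0; have dx : derivable (derive1n n psi) x 1.
    case: n => [|n]; first exact: psid.
    rewrite (_ : derive1n n.+1 psi = derive1n n (derive1 psi)); first exact: psid'.
    by apply/funext => y; rewrite derS.
  have := is_deriveZ ((-1) ^+ n.+1) (derivableP dx).
  rewrite -derive1E -[derive1 _ x]/(derive1n n.+1 psi x).
  by congr is_derive; rewrite /g /GRing.scale /= [in RHS]exprS; ring.
have g_ge0 n (x : R) : 0 < x -> 0 <= g n.+1 x.
  move=> x0; rewrite /g derS !exprS !mulN1r opprK; exact: psi_cm.
have Dsum i j : D i j <= \sum_i' \sum_j' D i' j'.
  rewrite (bigD1 i) //= (bigD1 j) //= -addrA lerDl.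
  by rewrite addr_ge0 ?sumr_ge0 // => k _; rewrite sumr_ge0.
pose M := 1 + \sum_i \sum_j D i j.
have M0 : 0 < M by rewrite ltr_wpDr // sumr_ge0 // => i _; rewrite sumr_ge0.
have DM i j : 0 <= D i j <= M.
  by rewrite D0 (le_trans (Dsum i j)) // lerDr.
have step e : 0 < e -> 0 <= qform (fun i j => g 0 (D i j + e)) a.
  move=> e0; set q := qform _ a; set c := (\sum_i \sum_j `|a i * a j|) * (M ^+ 2 * g 1 e).
  have c0 : 0 <= c.
    apply: mulr_ge0; first by apply: sumr_ge0 => i _; apply: sumr_ge0.
    by apply: mulr_ge0; [exact: sqr_ge0|exact: g_ge0].
  rewrite leNgt; apply/negP => q0.
  (* A negative [q] would satisfy [- q * b <= c], which fails for any [b] beyond [c / - q]. *)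
  pose b := M + 1 + c / - q.
  have cq : 0 <= c / - q by apply: divr_ge0 => //; lra.
  have b1 : M + 1 <= b by rewrite lerDl.
  have b0 : 0 < b by lra.
  have Mb : 0 < M < b by lra.
  have := bernstein_qform_ge derg g_ge0 Dcnd DM a0 e0 Mb.
  rewrite -/q mulrA -/c lerNl ler_pdivlMr //.
  rewrite mulrC /b mulrDl divfK ?oppr_eq0 ?lt_eqF //.
  by nra.
have cv : qform (fun i j => - g 0 (D i j + e)) a @[e --> 0^'+] -->
    qform (fun i j => psi (D i j)) a.
  apply: cvg_qform => i j; rewrite (_ : (fun _ => _) = (fun e => psi (D i j + e))).
    apply: (cvg_within_comp psic).
    - by rewrite /= in_itv /= D0.
    - rewrite -[X in _ --> X]addr0; apply: cvgD; first exact: cvg_cst.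
      exact: cvg_at_right_filter.
    apply: filterS (nbhs_right_ge _) => r r0.
    by rewrite /= in_itv /= andbT addr_ge0.
  by apply/funext => x; rewrite /g expr1 mulN1r opprK.
rewrite -(cvg_lim (@Rhausdorff R) cv).
apply: limr_le; first exact: (cvgP _ cv).
near=> e.
rewrite (@eq_qform _ _ _ (fun i j => (-1) * g 0 (D i j + e))); last first.
  by move=> i j; rewrite mulN1r.
rewrite qformZ mulN1r oppr_le0; apply: step.
by near: e; exact: nbhs_right_gt.
Unshelve. all: by end_near.
Qed.

(** * Mixtures over the Stieltjes measure *)

Definition halfline_pos (R : realType) : set R := [set` `](0 : R), +oo[].

(* As [phi 0] is finite, [0] carries no mass: the value [+oo] that
   [stieltjes_kernel] takes at [t = xi = 0] plays no role. *)
Lemma stieltjes_integral_pos (R : realType) (phi : R -> R) :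
  stieltjes_function phi ->
  exists mu : {measure set R -> \bar R}, forall t : R, 0 <= t ->
    mu.-integrable (@halfline_pos R) (fun xi : R => ((t + xi)^-1)%:E) /\
    (phi t)%:E = (\int[mu]_(xi in @halfline_pos R) ((t + xi)^-1)%:E)%E.
Proof.
move=> [mu [_ [_ phiE]]]; exists mu.
have mP : measurable (@halfline_pos R) by exact: measurable_itv.
have m0 : measurable [set (0 : R)] by exact: measurable_set1.
have D0E : @halfline0 R = @halfline_pos R `|` [set 0].
  apply/seteqP; split=> [x|x [|->]]; rewrite /halfline0 /halfline_pos /= !in_itv /= ?andbT //.
    by rewrite le_eqVlt => /orP[/eqP <-|]; [right|left].
  exact: ltW.
have mD0 : measurable (@halfline0 R) by exact: measurable_itv.
have k_ge0 (t xi : R) : 0 <= t -> @halfline0 R xi ->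
    (0 <= stieltjes_kernel t xi)%E.
  rewrite /halfline0 /= in_itv /= andbT => t0 xi0.
  by rewrite /stieltjes_kernel; case: ifP => // _; rewrite lee_fin invr_ge0 addr_ge0.
have kP (t : R) : 0 <= t ->
    {in @halfline_pos R, stieltjes_kernel t =1 fun xi : R => ((t + xi)^-1)%:E}.
  move=> t0 xi; rewrite inE /halfline_pos /= in_itv /= andbT => xi0.
  by rewrite /stieltjes_kernel gt_eqF // ltr_wpDl.
have mf (t : R) : 0 <= t ->
    measurable_fun (@halfline_pos R) ((fun xi => ((t + xi)^-1)%:E) : R -> \bar R).
  move=> t0; apply/measurable_EFinP; apply: open_continuous_measurable_fun.
    exact: interval_open.
  move=> xi; rewrite inE /halfline_pos /= in_itv /= andbT => xi0.
  apply: continuousV; first by rewrite gt_eqF // ltr_wpDl.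
  by apply: cvgD; [exact: cvg_cst|exact: cvg_id].
have mk (t : R) : 0 <= t -> measurable_fun (@halfline0 R) (stieltjes_kernel t).
  move=> t0; rewrite D0E; apply/measurable_funU => //; split.
    by apply/(measurable_fun_eqP _ (kP t t0)); exact: mf.
  exact: measurable_fun_set1.
have mu0 : mu [set 0] = 0%E.
  apply/eqP; rewrite -measure_le0 leNgt; apply/negP => mu_gt0.
  have : (\int[mu]_(xi in [set (0%R : R)]) stieltjes_kernel 0%R xi <= (phi 0)%:E)%E.
    rewrite phiE //; apply: ge0_subset_integral => //; first exact: mk.
      by move=> x; exact: k_ge0.
    by rewrite D0E; exact: subsetUr.
  rewrite (@eq_integral _ _ _ _ _ (cst +oo%E)) => [|x]; last first.
    by rewrite inE /= => ->; rewrite /stieltjes_kernel addr0 eqxx.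
  by rewrite integral_cst // gt0_mulye.
have phiP (t : R) : 0 <= t ->
    (phi t)%:E = (\int[mu]_(xi in @halfline_pos R) ((t + xi)^-1)%:E)%E.
  move=> t0; rewrite phiE // (ge0_negligible_integral m0 mD0 (mk t t0) _ mu0).
    rewrite (_ : _ `\` _ = @halfline_pos R).
      exact: eq_integral (kP t t0).
    rewrite D0E; apply/seteqP; split=> [x [[]]//|x /= x0].
    split; first by left.
    by move=> x00; move: x0; rewrite x00 /halfline_pos /= in_itv /= ltxx.
  by move=> x; exact: k_ge0.
move=> t t0; split; last exact: phiP.
apply/integrableP; split; first exact: mf.
rewrite [ltLHS](_ : _ = (phi t)%:E) ?ltry // phiP //; apply: eq_integral => xi.
rewrite inE /halfline_pos /= in_itv /= andbT => xi0.
by rewrite ger0_norm // invr_ge0 addr_ge0 // ltW.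
Qed.

(** Since [rho^-1 * (theta / rho + xi)^-1 = (theta + xi * rho)^-1], the form is the integral over
    [xi > 0] of nonnegative forms. *)
Lemma qform_stieltjes_ge0 (R : realType) (phi : R -> R) (I : finType)
    (theta rho : I -> I -> R) (a : I -> R) :
  stieltjes_function phi ->
  (forall i j, 0 <= theta i j) -> (forall i j, 0 < rho i j) ->
  (forall xi : R, 0 < xi -> psd (fun i j => (theta i j + xi * rho i j)^-1)) ->
  0 <= qform (fun i j => (rho i j)^-1 * phi (theta i j / rho i j)) a.
Proof.
move=> /stieltjes_integral_pos[mu phiE] theta0 rho0 psdN.
pose x (p : I * I) := theta p.1 p.2 / rho p.1 p.2.
have x0 p : 0 <= x p by rewrite divr_ge0 // ltW.
pose c (p : I * I) := a p.1 * a p.2 * (rho p.1 p.2)^-1.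
have -> : qform (fun i j => (rho i j)^-1 * phi (theta i j / rho i j)) a =
    \sum_p c p * phi (x p).
  by rewrite /qform pair_bigA; apply: eq_bigr => p _; rewrite mulrA.
have mP : measurable (@halfline_pos R) by exact: measurable_itv.
rewrite -lee_fin -sumEFin.
(* The coefficients [c p] may be negative, so the exchange of sum and integral uses integrability of
   each kernel. *)
have -> : \sum_p (c p * phi (x p))%:E =
    (\int[mu]_(xi in @halfline_pos R) (\sum_p ((c p)%:E * ((x p + xi)^-1)%:E)%E)%R)%E.
  rewrite integral_sum //; last first.
    by move=> p; apply: integrableZl => //; exact: (phiE _ (x0 p)).1.
  apply: eq_bigr => p _.
  by rewrite EFinM (phiE _ (x0 p)).2 integralZl //; exact: (phiE _ (x0 p)).1.
apply: integral_ge0 => xi; rewrite /halfline_pos /= in_itv /= andbT => xi0.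
under eq_bigr do rewrite -EFinM.
rewrite sumEFin lee_fin.
suff -> : \sum_p c p * (x p + xi)^-1 =
    qform (fun i j => (theta i j + xi * rho i j)^-1) a by exact: (psdN xi xi0).2.
rewrite /qform pair_bigA; apply: eq_bigr => p _; rewrite /c /x.
have r0 := rho0 p.1 p.2.
have : theta p.1 p.2 + xi * rho p.1 p.2 != 0.
  by rewrite gt_eqF // ltr_wpDl // mulr_gt0.
by move=> n0; field; rewrite n0 gt_eqF.
Qed.

Lemma psd_dotp (R : realType) (I : finType) (d : nat) (s : I -> 'rV[R]_d) :
  psd (fun i j => dotp (s i) (s j)).
Proof.
by apply: psd_sum => k; exact: (psd_rank1 (fun i => s i ord0 k)).
Qed.

Theorem theorem2 (R : realType) (sigma2 : R) (phi psi : R -> R) :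
  0 < sigma2 ->
  stieltjes_function phi -> phi 0 = 1 ->
  (forall x : R, 0 <= x -> 0 < psi x) ->
  {within `[0, +oo[, continuous psi} ->
  (forall x : R, 0 < x -> derivable psi x 1) ->
  completely_monotone (derive1 psi) ->
  forall d : nat, (0 < d)%N ->
    covariance_on_sphere_time d
      (fun theta u => sigma2 / psi (u ^+ 2) * phi (theta / psi (u ^+ 2))).
Proof.
move=> sigma0 phiS _ psi0 psiC psiD psi_cm d _ n s t a sS.
pose theta (k h : 'I_n) := gc_dist (s k) (s h).
pose rho (k h : 'I_n) := psi ((t k - t h) ^+ 2).
(* The minors of the Gram kernel put the dot products in [[-1, 1]]. *)
have theta0 k h : 0 <= theta k h.
  apply: acos_ge0; rewrite -ler_norml -sqrtr_sqr -[leRHS]sqrtr1 ler_sqrt //.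
  by rewrite (le_trans (psd_minor k h (psd_dotp s))) // !sS mulr1.
have rho0 k h : 0 < rho k h by apply: psi0; exact: sqr_ge0.
have theta_cnd : cnd theta by apply: cnd_acos; [exact: psd_dotp|exact: sS].
have rho_cnd : cnd rho.
  apply: (cnd_bernstein psiC psiD psi_cm); first exact: cnd_sqr_dist.
  by move=> k h; exact: sqr_ge0.
suff -> : \sum_(k < n) \sum_(h < n) a k * a h *
      (sigma2 / psi ((t k - t h) ^+ 2) *
       phi (gc_dist (s k) (s h) / psi ((t k - t h) ^+ 2))) =
    sigma2 * qform (fun k h => (rho k h)^-1 * phi (theta k h / rho k h)) a.
  apply: mulr_ge0; first exact: ltW.
  apply: qform_stieltjes_ge0 => // xi xi0; apply: cnd_inv => [|k h].
    by apply: cndD => //; apply: cndZ => //; exact: ltW.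
  by rewrite ltr_wpDl // mulr_gt0.
rewrite -qformZ; apply: eq_bigr => k _; apply: eq_bigr => h _.
by congr (_ * _); rewrite mulrA.
Qed.
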